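(* Let $R$ be a commutative ring with unity, $M$ a free $R$-module of finite rank $m$, $1\le k\le m$, and $\omega_1,\dots,\omega_k\in M$. Put $\Omega=\omega_1\wedge\cdots\wedge\omega_k$ and $K=\ker\omega_1\cap\cdots\cap\ker\omega_k\subset M^*$. Let $m\ge p\ge r\ge 1$. Assume that the ideal $I(\Omega)$ contains a non-zero-divisor of $R$. Let $\eta\in\Lambda^pM$. (i) If $\eta=\sum_{J\in\mathcal J(r,k)}\omega_J\wedge\gamma_J$ with $\gamma_J\in\Lambda^{p-r}M$, then the elements $\gamma_J$ are unique when restricted to $K$: for all $\alpha_1,\dots,\alpha_{p-r}\in K$ and all $J\in\mathcal J(r,k)$, the value $\gamma_J(\alpha_1,\dots,\alpha_{p-r})\in R$ is determined by $\eta$ and $\alpha_1,\dots,\alpha_{p-r}$ (it is the same for any two such representations of $\eta$). (ii) More generally, if $b\in R$ is a non-zero-divisor and $b\eta=\sum_{J\in\mathcal J(r,k)}\omega_J\wedge\gamma_J$ with $\gamma_J\in\Lambda^{p-r}M$, then the elements $\gamma_J/b$ are unique, independent of $b$, when restricted to $K$: for all $\alpha_1,\dots,\alpha_{p-r}\in K$ and $J\in\mathcal J(r,k)$, the element $\gamma_J(\alpha_1,\dots,\alpha_{p-r})/b$ of the total ring of fractions of $R$ is determined by $\eta$ and $\alpha_1,\dots,\alpha_{p-r}$ (it is the same for any two such representations, possibly with different non-zero-divisors $b$).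
   Context: $\Lambda^qM$ is the $q$th exterior power of $M$ ($\Lambda^0M=R$, $\Lambda^qM=0$ for $q<0$ or $q>m$). $M^*=\operatorname{Hom}_R(M,R)$. An element $\gamma\in\Lambda^qM$ is treated as a skew-symmetric $q$-linear form on $M^*$. For $\omega_i\in M$, $\ker\omega_i=\{g\in M^*: g(\omega_i)=0\}$. $\mathcal J(r,k)$ denotes the set of strictly increasing multiindices $J=(j_1,\dots,j_r)$ with $1\le j_1<\cdots<j_r\le k$, and $\omega_J=\omega_{j_1}\wedge\cdots\wedge\omega_{j_r}$. $I(\Omega)\subset R$ is the ideal generated by the coefficients of $\Omega$ in the basis of $\Lambda^kM$ induced by a basis of $M$ (independent of the basis). The total ring of fractions of $R$ is the localization $S^{-1}R$ at the multiplicative set $S$ of all non-zero-divisors of $R$. *)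

(* Defs.v *)
From HB Require Import structures.
From mathcomp Require Import all_boot all_order all_algebra.
From mathcomp Require Import boolp ring.

Set Implicit Arguments.
Unset Strict Implicit.
Unset Printing Implicit Defensive.
Import GRing.Theory.
Local Open Scope ring_scope.
Local Open Scope quotient_scope.

(* The exterior algebra of an arbitrary R-module M, i.e. T(M)/(u (x) u), by   *)
(* generators and relations: a formal sum is a list of terms (c, w) standing  *)
(* for c * w_1 ^ ... ^ w_n, and [ext_eq] is the least congruence making these *)
(* terms additive in c, linear in each letter, and zero when two adjacent     *)
(* letters are equal.                                                         *)
Section FormalSums.
Variables (R : comPzRingType) (M : lmodType R).

Local Notation fsum := (seq (R * seq M)).

Inductive ext_eq : fsum -> fsum -> Prop :=
| ExtRefl a : ext_eq a a
| ExtSym a b : ext_eq a b -> ext_eq b a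
| ExtTrans a b c : ext_eq a b -> ext_eq b c -> ext_eq a c
| ExtCat a a' b b' : ext_eq a a' -> ext_eq b b' -> ext_eq (a ++ b) (a' ++ b')
| ExtCatC a b : ext_eq (a ++ b) (b ++ a)
| ExtZero w : ext_eq [:: (0, w)] [::]
| ExtAdd c d w : ext_eq [:: (c + d, w)] [:: (c, w); (d, w)]
| ExtLin c s a u v t :
    ext_eq [:: (c, s ++ (a *: u + v) :: t)]
           [:: (c * a, s ++ u :: t); (c, s ++ v :: t)]
| ExtAlt c s u t : ext_eq [:: (c, s ++ u :: u :: t)] [::].

Definition ext_eqb (a b : fsum) : bool := `[< ext_eq a b >].

Lemma ext_eqb_refl : reflexive ext_eqb.
Proof. by move=> a; apply/asboolP; exact: ExtRefl. Qed.

Lemma ext_eqb_sym : symmetric ext_eqb.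
Proof. by move=> a b; apply/asboolP/asboolP; exact: ExtSym. Qed.

Lemma ext_eqb_trans : transitive ext_eqb.
Proof.
by move=> b a c /asboolP ab /asboolP bc; apply/asboolP; exact: ExtTrans bc.
Qed.

Canonical ext_equiv :=
  EquivRel ext_eqb ext_eqb_refl ext_eqb_sym ext_eqb_trans.

Definition ext := {eq_quot ext_eqb}.
HB.instance Definition _ : EqQuotient _ ext_eqb ext := EqQuotient.on ext.
HB.instance Definition _ := Choice.on ext.

Lemma ext_piP (a b : fsum) : reflect (ext_eq a b) (\pi_ext a == \pi_ext b).
Proof. by rewrite eqmodE; exact: asboolP. Qed.

Lemma ext_repr a : ext_eq (repr (\pi_ext a)) a.
Proof. by apply/ext_piP; rewrite reprK. Qed.

Definition fscale (k : R) (a : fsum) : fsum := [seq (k * t.1, t.2) | t <- a].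

Definition fmul (a b : fsum) : fsum :=
  [seq (t.1 * u.1, t.2 ++ u.2) | t <- a, u <- b].

Lemma fmul_nill b : fmul [::] b = [::]. Proof. by []. Qed.

Lemma fmul_nilr a : fmul a [::] = [::].
Proof. by elim: a. Qed.

Lemma fmul_catl a b c : fmul (a ++ b) c = fmul a c ++ fmul b c.
Proof. exact: allpairs_cat. Qed.

Lemma fscale_cat k a b : fscale k (a ++ b) = fscale k a ++ fscale k b.
Proof. exact: map_cat. Qed.

Lemma ext_eq_catCA a b c : ext_eq (a ++ b ++ c) (b ++ a ++ c).
Proof. by rewrite !catA; apply: ExtCat (ExtRefl _); exact: ExtCatC. Qed.

Lemma ext_eq_perm (a b : fsum) : perm_eq a b -> ext_eq a b.
Proof.
move=> ab; apply: (@catCA_perm_ind _ (fun c => ext_eq a c)) ab _.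
  by move=> x y z h; apply: ExtTrans h _; exact: ext_eq_catCA.
exact: ExtRefl.
Qed.

Lemma ext_eq_scale k a b : ext_eq a b -> ext_eq (fscale k a) (fscale k b).
Proof.
elim=> {a b}.
- by move=> a; exact: ExtRefl.
- by move=> a b _; exact: ExtSym.
- by move=> a b c _ h _; exact: ExtTrans.
- by move=> a a' b b' _ h _ h'; rewrite !fscale_cat; exact: ExtCat.
- by move=> a b; rewrite !fscale_cat; exact: ExtCatC.
- by move=> w; rewrite /fscale /= mulr0; exact: ExtZero.
- by move=> c d w; rewrite /fscale /= mulrDr; exact: ExtAdd.
- by move=> c s a u v t; rewrite /fscale /= mulrA; exact: ExtLin.
- by move=> c s u t; exact: ExtAlt.
Qed.

Lemma fmul_catr a b c : ext_eq (fmul a (b ++ c)) (fmul a b ++ fmul a c).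
Proof. by apply: ext_eq_perm; apply/permPl; exact: (perm_allpairs_catr _ _ (fun=> b)). Qed.

Lemma ext_eq_mull a b c : ext_eq a b -> ext_eq (fmul a c) (fmul b c).
Proof.
have f1 t b' : fmul [:: t] b' = [seq (t.1 * u.1, t.2 ++ u.2) | u <- b'].
  by rewrite /fmul /= cats0.
have step x y : (forall d z, ext_eq (fmul x [:: (d, z)]) (fmul y [:: (d, z)])) ->
    ext_eq (fmul x c) (fmul y c).
  move=> h; elim: c => [|[d z] c ih]; first by rewrite !fmul_nilr; exact: ExtRefl.
  rewrite -cat1s.
  apply: ExtTrans (fmul_catr _ _ _) _; apply: ExtTrans (ExtSym (fmul_catr _ _ _)).
  exact: ExtCat.
elim=> {a b}.
- by move=> a; exact: ExtRefl.
- by move=> a b _; exact: ExtSym.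
- by move=> a b c' _ h _; exact: ExtTrans.
- by move=> a a' b b' _ h _ h'; rewrite !fmul_catl; exact: ExtCat.
- by move=> a b; rewrite !fmul_catl; exact: ExtCatC.
- by move=> w; apply: step => d z; rewrite /fmul /= mul0r; exact: ExtZero.
- by move=> k l w; apply: step => d z; rewrite /fmul /= mulrDl; exact: ExtAdd.
- move=> k s a u v t; apply: step => d z.
  by rewrite /fmul /= -!catA !cat_cons mulrAC; exact: ExtLin.
- move=> k s u t; apply: step => d z.
  by rewrite /fmul /= -!catA !cat_cons; exact: ExtAlt.
Qed.

Lemma ext_eq_mulr a b c : ext_eq a b -> ext_eq (fmul c a) (fmul c b).
Proof.
have step x y : (forall d z, ext_eq (fmul [:: (d, z)] x) (fmul [:: (d, z)] y)) ->
    ext_eq (fmul c x) (fmul c y).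
  move=> h; elim: c => [|[d z] c ih]; first exact: ExtRefl.
  by rewrite -cat1s !fmul_catl; exact: ExtCat.
elim=> {a b}.
- by move=> a; exact: ExtRefl.
- by move=> a b _; exact: ExtSym.
- by move=> a b c' _ h _; exact: ExtTrans.
- move=> a a' b b' _ h _ h'.
  apply: ExtTrans (fmul_catr _ _ _) _; apply: ExtTrans (ExtSym (fmul_catr _ _ _)).
  exact: ExtCat.
- move=> a b.
  apply: ExtTrans (fmul_catr _ _ _) _; apply: ExtTrans (ExtSym (fmul_catr _ _ _)).
  exact: ExtCatC.
- by move=> w; apply: step => d z; rewrite /fmul /= mulr0; exact: ExtZero.
- by move=> k l w; apply: step => d z; rewrite /fmul /= mulrDr; exact: ExtAdd.
- move=> k s a u v t; apply: step => d z.
  by rewrite /fmul /= !catA mulrA; exact: ExtLin.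
- by move=> k s u t; apply: step => d z; rewrite /fmul /= catA; exact: ExtAlt.
Qed.

Definition ext_zero : ext := \pi_ext [::].
Definition ext_one : ext := \pi_ext [:: (1, [::])].
Definition ext_add := lift_op2 ext (fun a b : fsum => a ++ b).
Definition ext_scale (k : R) := lift_op1 ext (fscale k).
Definition ext_opp (x : ext) : ext := ext_scale (-1) x.
Definition ext_mul := lift_op2 ext fmul.

Lemma ext_addE a b : ext_add (\pi_ext a) (\pi_ext b) = \pi_ext (a ++ b).
Proof. by unlock ext_add; apply/eqP/ext_piP; apply: ExtCat; exact: ext_repr. Qed.

Lemma ext_scaleE k a : ext_scale k (\pi_ext a) = \pi_ext (fscale k a).
Proof. by unlock ext_scale; apply/eqP/ext_piP; apply: ext_eq_scale; exact: ext_repr. Qed.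

Lemma ext_mulE a b : ext_mul (\pi_ext a) (\pi_ext b) = \pi_ext (fmul a b).
Proof.
unlock ext_mul; apply/eqP/ext_piP; apply: ExtTrans (ext_eq_mull _ (ext_repr a)) _.
by apply: ext_eq_mulr; exact: ext_repr.
Qed.

Lemma ext_addA : associative ext_add.
Proof. by elim/quotW=> a; elim/quotW=> b; elim/quotW=> c; rewrite !ext_addE catA. Qed.

Lemma ext_addC : commutative ext_add.
Proof.
by elim/quotW=> a; elim/quotW=> b; rewrite !ext_addE; apply/eqP/ext_piP; exact: ExtCatC.
Qed.

Lemma ext_add0 : left_id ext_zero ext_add.
Proof. by elim/quotW=> a; rewrite ext_addE. Qed.

Lemma fscaleDl k l a : ext_eq (fscale (k + l) a) (fscale k a ++ fscale l a).
Proof.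
elim: a => [|[c w] a ih]; first exact: ExtRefl.
rewrite /= mulrDl.
apply: (ExtTrans (ExtCat (ExtAdd (k * c) (l * c) w) ih)).
exact: (ExtCat (ExtRefl [:: (k * c, w)]) (ext_eq_catCA [:: (l * c, w)] _ _)).
Qed.

Lemma fscale0 a : ext_eq (fscale 0 a) [::].
Proof.
elim: a => [|[c w] a ih]; first exact: ExtRefl.
rewrite /= mul0r; exact: (ExtCat (ExtZero w) ih).
Qed.

Lemma fscale1 a : fscale 1 a = a.
Proof. by elim: a => [//|[c w] a /= ->]; rewrite mul1r. Qed.

Lemma ext_addN : left_inverse ext_zero ext_opp ext_add.
Proof.
elim/quotW=> a; rewrite /ext_opp ext_scaleE ext_addE; apply/eqP/ext_piP.
rewrite -{2}[a]fscale1; apply: ExtTrans (ExtSym (fscaleDl _ _ _)) _.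
by rewrite addNr; exact: fscale0.
Qed.

HB.instance Definition _ :=
  GRing.isZmodule.Build ext ext_addA ext_addC ext_add0 ext_addN.

Lemma ext_scaleA a b v : ext_scale a (ext_scale b v) = ext_scale (a * b) v.
Proof.
elim/quotW: v => v; rewrite !ext_scaleE /fscale -map_comp.
by congr (\pi_ext _); apply: eq_map => t /=; rewrite mulrA.
Qed.

Lemma ext_scale1 : left_id 1 ext_scale.
Proof. by elim/quotW=> a; rewrite ext_scaleE fscale1. Qed.

Lemma ext_scaleDr : right_distributive ext_scale +%R.
Proof.
move=> k; elim/quotW=> a; elim/quotW=> b.
by rewrite /GRing.add /= !(ext_addE, ext_scaleE) fscale_cat.
Qed.

Lemma ext_scaleDl v : {morph ext_scale^~ v : a b / a + b}.
Proof.
elim/quotW: v => v a b /=; rewrite [in RHS]/GRing.add /= !ext_scaleE ext_addE.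
by apply/eqP/ext_piP; exact: fscaleDl.
Qed.

HB.instance Definition _ := GRing.Zmodule_isLmodule.Build R ext
  ext_scaleA ext_scale1 ext_scaleDr ext_scaleDl.

Lemma fmulA a b c : fmul a (fmul b c) = fmul (fmul a b) c.
Proof.
elim: a => [//|t a ih]; rewrite -[t :: a]cat1s (fmul_catl [:: t] a) (fmul_catl [:: t] a b).
rewrite (fmul_catl (fmul [:: t] b)) ih; congr (_ ++ _).
elim: b {ih} => [//|u b ihb].
have f1 x y : fmul [:: t] (x ++ y) = fmul [:: t] x ++ fmul [:: t] y.
  by rewrite /fmul /= !cats0 map_cat.
rewrite -[u :: b]cat1s (fmul_catl [:: u]) (f1 (fmul [:: u] c)) (f1 [:: u]).
rewrite (fmul_catl (fmul [:: t] [:: u])) ihb; congr (_ ++ _).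
rewrite /fmul /= !cats0 -map_comp.
by apply: eq_map => v /=; rewrite mulrA catA.
Qed.

Lemma ext_mulA : associative ext_mul.
Proof. by elim/quotW=> a; elim/quotW=> b; elim/quotW=> c; rewrite !ext_mulE fmulA. Qed.

Lemma ext_mul1l : left_id ext_one ext_mul.
Proof.
elim/quotW=> a; rewrite ext_mulE /fmul /= cats0; congr (\pi_ext _).
by rewrite -[RHS]map_id; apply: eq_map => -[c w] /=; rewrite mul1r.
Qed.

Lemma ext_mul1r : right_id ext_one ext_mul.
Proof.
elim/quotW=> a; rewrite ext_mulE; congr (\pi_ext _).
by elim: a => [//|[c w] a ih]; rewrite -cat1s fmul_catl ih /fmul /= mulr1 cats0.
Qed.

Lemma ext_mulDl : left_distributive ext_mul +%R.
Proof.
by elim/quotW=> a; elim/quotW=> b; elim/quotW=> c; rewrite /GRing.add /= !(ext_addE, ext_mulE) fmul_catl.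
Qed.

Lemma ext_mulDr : right_distributive ext_mul +%R.
Proof.
elim/quotW=> a; elim/quotW=> b; elim/quotW=> c; rewrite /GRing.add /= !(ext_addE, ext_mulE).
by apply/eqP/ext_piP; exact: fmul_catr.
Qed.

HB.instance Definition _ := GRing.Zmodule_isPzRing.Build ext
  ext_mulA ext_mul1l ext_mul1r ext_mulDl ext_mulDr.

(* MathComp's algebras are nontrivial rings, and R may be the zero ring: the  *)
(* R-algebra axioms are therefore stated as the next two lemmas.              *)
Lemma ext_scalerAl (k : R) (x y : ext) : k *: (x * y) = (k *: x) * y.
Proof.
elim/quotW: x => a; elim/quotW: y => b.
rewrite /GRing.scale /GRing.mul /= !(ext_mulE, ext_scaleE); congr (\pi_ext _).
elim: a => [//|t a ih]; rewrite -cat1s fscale_cat !fmul_catl fscale_cat ih.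
congr (_ ++ _); rewrite /fmul /fscale /= !cats0 -map_comp.
by apply: eq_map => u /=; rewrite mulrA.
Qed.

Lemma ext_scalerAr (k : R) (x y : ext) : k *: (x * y) = x * (k *: y).
Proof.
elim/quotW: x => a; elim/quotW: y => b.
rewrite /GRing.scale /GRing.mul /= !(ext_mulE, ext_scaleE); congr (\pi_ext _).
elim: a => [//|t a ih]; rewrite -cat1s !fmul_catl fscale_cat ih.
congr (_ ++ _); rewrite /fmul /fscale /= !cats0 -!map_comp.
by apply: eq_map => u /=; rewrite mulrCA.
Qed.

Definition ext_in (v : M) : ext := \pi_ext [:: (1, [:: v])].

Lemma ext_in_linear : linear ext_in.
Proof.
move=> a u v; rewrite /GRing.add /GRing.scale /= ext_scaleE ext_addE.
apply/eqP/ext_piP; rewrite /fscale /=.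
by have := ExtLin 1 [::] a u v [::]; rewrite !mul1r mulr1.
Qed.

HB.instance Definition _ :=
  GRing.isLinear.Build R M ext _ ext_in ext_in_linear.

Lemma ext_in_sqr v : ext_in v * ext_in v = 0.
Proof.
rewrite /GRing.mul /= ext_mulE; apply/eqP/ext_piP; rewrite /fmul /= mulr1.
exact: (ExtAlt 1 [::] v [::]).
Qed.

(* The identification of an element of degree q with an alternating q-linear  *)
(* form on M^*, normalized by                                                 *)
(*   (w_1 ^ ... ^ w_q)(alpha_1, ..., alpha_q) = det (alpha_j (w_i)).          *)
Section Form.
Variables (q : nat) (alpha : 'I_q -> {scalar M}).

Definition word_form (w : seq M) : R :=
  if size w == q then \det (\matrix_(i < q, j < q) alpha j (nth 0 w i)) else 0.

Definition fsum_form (a : fsum) : R := \sum_(t <- a) t.1 * word_form t.2.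

Definition ext_form (x : ext) : R := fsum_form (repr x).

Lemma word_form_lin s a u v t :
  word_form (s ++ (a *: u + v) :: t) =
  a * word_form (s ++ u :: t) + word_form (s ++ v :: t).
Proof.
rewrite /word_form !size_cat /=; case: eqP => [szq|_]; last by rewrite mulr0 addr0.
have lt_s : (size s < q)%N by rewrite -szq addnS ltnS leq_addr.
pose i0 := Ordinal lt_s.
rewrite -[X in _ = _ + X]mul1r.
have ntE x y i : i != i0 -> nth 0 (s ++ x :: t) i = nth 0 (s ++ y :: t) i.
  move=> ne; rewrite !nth_cat; case: ltnP => // le.
  have : (size s < i)%N.
    by rewrite ltn_neqAle le andbT; apply: contra ne => /eqP h; apply/eqP/val_inj.
  by rewrite -subn_gt0; case: (i - size s)%N.
apply: (@determinant_multilinear _ _ _ _ _ i0).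
- apply/rowP => j; rewrite !mxE /= !nth_cat ltnn subnn /= linearD linearZ /=.
  by rewrite mul1r.
- by apply/matrixP => i j; rewrite !mxE; congr (alpha _ _); apply: ntE; rewrite eq_sym neq_lift.
- by apply/matrixP => i j; rewrite !mxE; congr (alpha _ _); apply: ntE; rewrite eq_sym neq_lift.
Qed.

Lemma word_form_alt s u t : word_form (s ++ u :: u :: t) = 0.
Proof.
rewrite /word_form !size_cat /=; case: eqP => [szq|//].
have lt1 : (size s < q)%N by rewrite -szq addnS ltnS leq_addr.
have lt2 : ((size s).+1 < q)%N by rewrite -szq !addnS !ltnS leq_addr.
apply: (@determinant_alternate _ _ _ (Ordinal lt1) (Ordinal lt2)).
  by rewrite -val_eqE /= neq_ltn ltnSn.
move=> j; rewrite !mxE /= !nth_cat ltnn subnn /=.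
by rewrite ltnNge leqnSn /= subSnn.
Qed.

Lemma fsum_form_cat a b : fsum_form (a ++ b) = fsum_form a + fsum_form b.
Proof. exact: big_cat. Qed.

Lemma fsum_form_eq a b : ext_eq a b -> fsum_form a = fsum_form b.
Proof.
elim=> {a b} //.
- by move=> a b c _ -> _ ->.
- by move=> a a' b b' _ ha _ hb; rewrite !fsum_form_cat ha hb.
- by move=> a b; rewrite !fsum_form_cat addrC.
- by move=> w; rewrite /fsum_form big_seq1 big_nil mul0r.
- by move=> c d w; rewrite /fsum_form !big_cons !big_nil /= !addr0 mulrDl.
- move=> c s a u v t; rewrite /fsum_form !big_cons !big_nil /= !addr0.
  by rewrite word_form_lin mulrDr mulrA.
- by move=> c s u t; rewrite /fsum_form big_seq1 big_nil word_form_alt mulr0.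
Qed.

Lemma ext_form_pi a : ext_form (\pi_ext a) = fsum_form a.
Proof. by apply: fsum_form_eq; exact: ext_repr. Qed.

Lemma ext_form_linear : linear_for *%R ext_form.
Proof.
move=> k; elim/quotW=> a; elim/quotW=> b.
rewrite [in LHS]/GRing.add /GRing.scale /= ext_scaleE ext_addE !ext_form_pi.
rewrite fsum_form_cat; congr (_ + _); rewrite /fsum_form big_map big_distrr /=.
by apply: eq_bigr => t _; rewrite mulrA.
Qed.

HB.instance Definition _ :=
  GRing.isLinear.Build R ext R _ ext_form ext_form_linear.

Lemma ext_prod (I : Type) (s : seq I) (w : I -> M) :
  \prod_(i <- s) ext_in (w i) = \pi_ext [:: (1, [seq w i | i <- s])].
Proof.
elim: s => [|i s ih]; first by rewrite big_nil.
by rewrite big_cons ih /GRing.mul /= ext_mulE /fmul /= mulr1.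
Qed.

Lemma ext_form_prod (w : 'I_q -> M) :
  ext_form (\prod_(i < q) ext_in (w i)) =
  \det (\matrix_(i < q, j < q) alpha j (w i)).
Proof.
rewrite -(big_map w xpredT ext_in) -[X in map w X]enumT.
rewrite (ext_prod _ id) map_id ext_form_pi /fsum_form big_seq1 mul1r /word_form.
rewrite size_map size_enum_ord eqxx; congr (\det _); apply/matrixP => i j.
by rewrite !mxE (nth_map i) ?size_enum_ord // nth_ord_enum.
Qed.

End Form.

(* Lambda^q M inside the exterior algebra. *)
Definition ext_deg (q : nat) (x : ext) : Prop :=
  exists s : seq (R * q.-tuple M),
    x = \sum_(t <- s) t.1 *: \prod_(v <- t.2) ext_in v.

End FormalSums.

Arguments ext_in {R M} v.

Definition incr_idx (r k : nat) : {set {ffun 'I_r -> 'I_k}} :=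
  [set J : {ffun 'I_r -> 'I_k} |
    [forall i : 'I_r, forall j : 'I_r, (i < j)%N ==> (J i < J j)%N]].

Section Wedges.
Variables (R : comPzRingType) (M : lmodType R).

Definition wedge (k : nat) (w : 'I_k -> M) : ext M :=
  \prod_(i < k) ext_in (w i).

Definition wedge_idx (r k : nat) (w : 'I_k -> M) (J : {ffun 'I_r -> 'I_k}) :
  ext M := wedge (fun i => w (J i)).

Definition is_basis (m : nat) (e : 'I_m -> M) : Prop :=
  forall v : M, exists! c : {ffun 'I_m -> R}, v = \sum_(i < m) c i *: e i.

Definition ext_coords (m : nat) (e : 'I_m -> M) (q : nat) (x : ext M)
    (c : {ffun 'I_q -> 'I_m} -> R) : Prop :=
  x = \sum_(J in incr_idx q m) c J *: wedge_idx e J.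

(* When e is a basis, the monomials [wedge_idx e J] form a basis of Lambda^q,  *)
(* so that c is the (unique) family of coefficients of x of degree q.         *)
Definition coef_ideal (m : nat) (e : 'I_m -> M) (q : nat) (x : ext M) (a : R) :
    Prop :=
  exists2 c : {ffun 'I_q -> 'I_m} -> R, ext_coords e x c &
    exists d : {ffun 'I_q -> 'I_m} -> R, a = \sum_(J in incr_idx q m) d J * c J.

Definition in_ker (w : M) (g : {scalar M}) : Prop := g w = 0.

End Wedges.

(* The total ring of fractions.  [GRing.lreg s] says that s is not a zero     *)
(* divisor.  Since denominators are cancellable, a / s = b / t iff a t = s b. *)
Section TotalFractions.
Variable R : comPzRingType.

Local Notation nzd := {s : R | `[< GRing.lreg s >]}.
Local Notation ratios := (R * nzd)%type.

Definition mk_nzd (s : R) (hs : GRing.lreg s) : nzd := exist _ s (asboolT hs).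

Lemma nzdP (s : nzd) : GRing.lreg (val s).
Proof. exact/asboolP/(valP s). Qed.

Definition frac_eq (x y : ratios) : bool := x.1 * val y.2 == val x.2 * y.1.

Lemma frac_eq_refl : reflexive frac_eq.
Proof. by move=> x; rewrite /frac_eq mulrC. Qed.

Lemma frac_eq_sym : symmetric frac_eq.
Proof.
by move=> x y; rewrite /frac_eq eq_sym; congr (_ == _); rewrite mulrC.
Qed.

Lemma frac_eq_trans : transitive frac_eq.
Proof.
move=> [b t] [a s] [c u]; rewrite /frac_eq /= => /eqP h1 /eqP h2; apply/eqP.
apply: (@nzdP t).
by rewrite mulrA [val t * a]mulrC h1 -mulrA h2 mulrCA.
Qed.

Canonical frac_equiv :=
  EquivRel frac_eq frac_eq_refl frac_eq_sym frac_eq_trans.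

Definition total_frac := {eq_quot frac_eq}.
HB.instance Definition _ : EqQuotient _ frac_eq total_frac :=
  EqQuotient.on total_frac.
HB.instance Definition _ := Choice.on total_frac.

Definition tfrac (a s : R) (hs : GRing.lreg s) : total_frac :=
  \pi_total_frac (a, mk_nzd hs).

Lemma tfracP a s (hs : GRing.lreg s) b t (ht : GRing.lreg t) :
  tfrac a hs = tfrac b ht <-> a * t = s * b.
Proof.
by split=> [/eqP|h]; [|apply/eqP]; rewrite /tfrac eqmodE /= /frac_eq /=;
  [move/eqP|apply/eqP].
Qed.

Lemma frac_ind (P : total_frac -> Prop) :
  (forall a s (hs : GRing.lreg s), P (tfrac a hs)) -> forall x, P x.
Proof.
move=> h; elim/quotW=> -[a s]; rewrite (_ : s = mk_nzd (@nzdP s)); first exact: h.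
exact: val_inj.
Qed.

Let num (x : total_frac) : R := (repr x).1.
Let den (x : total_frac) : R := val (repr x).2.
Let den_reg x : GRing.lreg (den x). Proof. exact: nzdP. Qed.
Let num_den a s (hs : GRing.lreg s) :
  num (tfrac a hs) * s = den (tfrac a hs) * a.
Proof.
have /eqP : repr (tfrac a hs) == (a, mk_nzd hs) %[mod total_frac].
  by rewrite reprK.
by move/eqP; rewrite eqmodE => /eqP.
Qed.

Definition frac_zero := tfrac 0 (@lreg1 R).
Definition frac_one := tfrac 1 (@lreg1 R).
Definition frac_add := locked (fun x y : total_frac =>
  tfrac (num x * den y + num y * den x) (lregM (@den_reg x) (@den_reg y))).
Definition frac_opp := locked (fun x : total_frac => tfrac (- num x) (@den_reg x)).
Definition frac_mul := locked (fun x y : total_frac =>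
  tfrac (num x * num y) (lregM (@den_reg x) (@den_reg y))).

Lemma frac_addE a s (hs : GRing.lreg s) b t (ht : GRing.lreg t) :
  frac_add (tfrac a hs) (tfrac b ht) = tfrac (a * t + b * s) (lregM hs ht).
Proof.
rewrite /frac_add -lock; apply/tfracP; have := num_den b ht; have := num_den a hs.
move: (num (tfrac a hs)) (den (tfrac a hs)) => a' s' ha.
move: (num (tfrac b ht)) (den (tfrac b ht)) => b' t' hb.
transitivity ((a' * s) * t' * t + (b' * t) * s' * s); first by ring.
by rewrite ha hb; ring.
Qed.

Lemma frac_oppE a s (hs : GRing.lreg s) : frac_opp (tfrac a hs) = tfrac (- a) hs.
Proof.
by rewrite /frac_opp -lock; apply/tfracP; rewrite mulNr mulrN num_den.
Qed.

Lemma frac_mulE a s (hs : GRing.lreg s) b t (ht : GRing.lreg t) :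
  frac_mul (tfrac a hs) (tfrac b ht) = tfrac (a * b) (lregM hs ht).
Proof.
by rewrite /frac_mul -lock; apply/tfracP; rewrite mulrACA !num_den mulrACA.
Qed.

Lemma frac_addA : associative frac_add.
Proof.
elim/frac_ind=> a s hs; elim/frac_ind=> b t ht; elim/frac_ind=> c u hu.
by rewrite !frac_addE; apply/tfracP; ring.
Qed.

Lemma frac_addC : commutative frac_add.
Proof.
elim/frac_ind=> a s hs; elim/frac_ind=> b t ht.
by rewrite !frac_addE; apply/tfracP; rewrite addrC mulrC [t * s]mulrC.
Qed.

Lemma frac_add0 : left_id frac_zero frac_add.
Proof.
elim/frac_ind=> a s hs; rewrite frac_addE; apply/tfracP.
by rewrite mul0r add0r mulr1 mul1r mulrC.
Qed.

Lemma frac_addN : left_inverse frac_zero frac_opp frac_add.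
Proof.
elim/frac_ind=> a s hs; rewrite frac_oppE frac_addE; apply/tfracP.
by rewrite mulNr addNr mul0r mulr0.
Qed.

HB.instance Definition _ :=
  GRing.isZmodule.Build total_frac frac_addA frac_addC frac_add0 frac_addN.

Lemma frac_mulA : associative frac_mul.
Proof.
elim/frac_ind=> a s hs; elim/frac_ind=> b t ht; elim/frac_ind=> c u hu.
by rewrite !frac_mulE; apply/tfracP; ring.
Qed.

Lemma frac_mulC : commutative frac_mul.
Proof.
elim/frac_ind=> a s hs; elim/frac_ind=> b t ht.
by rewrite !frac_mulE; apply/tfracP; rewrite mulrC [t * s]mulrC [a * b]mulrC.
Qed.

Lemma frac_mul1 : left_id frac_one frac_mul.
Proof.
elim/frac_ind=> a s hs; rewrite frac_mulE; apply/tfracP.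
by rewrite !mul1r mulrC.
Qed.

Lemma frac_mulDl : left_distributive frac_mul +%R.
Proof.
elim/frac_ind=> a s hs; elim/frac_ind=> b t ht; elim/frac_ind=> c u hu.
rewrite /GRing.add /= !(frac_addE, frac_mulE); apply/tfracP.
by ring.
Qed.

HB.instance Definition _ := GRing.Zmodule_isComPzRing.Build total_frac
  frac_mulA frac_mulC frac_mul1 frac_mulDl.

Definition tofrac (a : R) : total_frac := tfrac a (@lreg1 R).

Lemma tofrac_zmod_morphism : zmod_morphism tofrac.
Proof.
move=> a b; rewrite /tofrac [in RHS]/GRing.opp [in RHS]/GRing.add /=.
by rewrite frac_oppE frac_addE; apply/tfracP; rewrite !(mulr1, mul1r).
Qed.

Lemma tofrac_monoid_morphism : monoid_morphism tofrac.
Proof.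
split=> [//|a b]; rewrite /tofrac [in RHS]/GRing.mul /= frac_mulE.
by apply/tfracP; rewrite !(mulr1, mul1r).
Qed.

HB.instance Definition _ :=
  GRing.isZmodMorphism.Build R total_frac tofrac tofrac_zmod_morphism.
HB.instance Definition _ :=
  GRing.isMonoidMorphism.Build R total_frac tofrac tofrac_monoid_morphism.

Lemma frac_mulK a s (hs : GRing.lreg s) : tfrac a hs * tofrac s = tofrac a.
Proof.
rewrite /tofrac /GRing.mul /= frac_mulE; apply/tfracP.
by rewrite !mulr1 mulrC.
Qed.

End TotalFractions.

Arguments tfrac {R} a {s} hs.

(* Main.v *)
Require Import Defs.
From HB Require Import structures.
From mathcomp Require Import all_boot all_order all_algebra.
From mathcomp Require Import all_fingroup boolp.

(** Suppose the sum of the omega_J ^ gamma_J vanishes. Multiplying it by the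
    wedge of the omega_i with i outside J leaves only +- Omega ^ gamma_J.
    Evaluating this on (beta_1, ..., beta_k, alpha_1, ..., alpha_(p-r)) with
    the alpha_j in K gives a block triangular determinant, so that
    Omega(beta) * gamma_J(alpha) = 0 for all beta. For beta running through the
    dual basis this says that I(Omega) annihilates gamma_J(alpha), which is
    therefore 0. Both statements follow by taking linear combinations. *)

Set Implicit Arguments.
Unset Strict Implicit.
Unset Printing Implicit Defensive.
Import GRing.Theory.
Local Open Scope ring_scope.

(** * Determinants attached to words of vectors *)

Section WordForm.
Variables (R : comPzRingType) (M : lmodType R).

Definition forms_cat (k q : nat) (beta : 'I_k -> {scalar M})
    (alpha : 'I_q -> {scalar M}) (j : 'I_(k + q)) : {scalar M} :=
  match split j with inl a => beta a | inr b => alpha b end.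

(** Rows are indexed by letters and columns by forms, so the vanishing of [alpha] on [w] kills the
    upper right block. If [z] does not have length [q], both sides are 0 by the default value of
    [word_form]. *)
Lemma word_form_cat (k q : nat) (beta : 'I_k -> {scalar M})
    (alpha : 'I_q -> {scalar M}) (w z : seq M) :
  size w = k -> (forall v j, v \in w -> alpha j v = 0) ->
  word_form (forms_cat beta alpha) (w ++ z) = word_form beta w * word_form alpha z.
Proof.
move=> szw w0; rewrite /word_form size_cat szw eqxx eqn_add2l.
case: eqP => [szz|_]; last by rewrite mulr0.
(* The lower left block, [beta] evaluated on [z], does not affect the determinant but has to be
   supplied. *)
rewrite -(det_lblock _ (\matrix_(i, j) beta j (nth 0 z i))); congr (\det _).
apply/matrixP => i j; rewrite !mxE /forms_cat.
rewrite nth_cat szw; case: (splitP i) => i' ->; rewrite !mxE.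
  case: (splitP j) => j' _; rewrite !mxE //.
  by apply: w0; apply: mem_nth; rewrite szw.
by rewrite addKn; case: (splitP j) => j' _; rewrite !mxE.
Qed.

(** The factorisation for words passes to a representative of [x] term by term. Mixed degrees are
    harmless: terms of degree other than [q] contribute 0 to both sides. *)
Lemma ext_form_catM (k q : nat) (beta : 'I_k -> {scalar M})
    (alpha : 'I_q -> {scalar M}) (w : seq M) (x : ext M) :
  size w = k -> (forall v j, v \in w -> alpha j v = 0) ->
  ext_form (forms_cat beta alpha) (\prod_(v <- w) ext_in v * x) =
  word_form beta w * ext_form alpha x.
Proof.
move=> szw w0; elim/quotW: x => a.
rewrite (ext_prod _ id) map_id /GRing.mul /= ext_mulE !ext_form_pi.
rewrite /fsum_form /fmul /= cats0 big_map [RHS]big_distrr /=.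
apply: eq_bigr => t _; rewrite mul1r word_form_cat //.
exact: mulrCA.
Qed.

Lemma word_form_nuniq (k : nat) (beta : 'I_k -> {scalar M}) (w : seq M) :
  ~~ uniq w -> word_form beta w = 0.
Proof.
rewrite /word_form; case: eqP => // szw /(uniqPn 0) [i [j [ij jw eq_ij]]].
rewrite szw in jw; have ik := ltn_trans ij jw.
apply: (@determinant_alternate _ _ _ (Ordinal ik) (Ordinal jw)).
  by rewrite -val_eqE /= ltn_eqF.
by move=> l; rewrite !mxE /= eq_ij.
Qed.

(** Permuting letters permutes rows. The sign is left unspecified because it will only be
    cancelled. *)
Lemma word_form_perm (k : nat) (beta : 'I_k -> {scalar M}) (w w' : seq M) :
  perm_eq w w' -> exists b : bool, word_form beta w = (-1) ^+ b * word_form beta w'.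
Proof.
move=> ww'; have szww' := perm_size ww'.
case: (eqVneq (size w') k) => [szw'|ne]; last first.
  (* On words of the wrong length both values are 0, so any sign will do. *)
  by exists false; rewrite /word_form szww' (negPf ne) mulr0.
have szw'b : size w' == k by rewrite szw'.
have [s eq_w] := tuple_permP (t := Tuple szw'b) ww'.
exists (odd_perm s); rewrite /word_form szww' szw'b -det_perm -det_mulmx.
rewrite -row_permE; congr (\det _); apply/matrixP => i j.
rewrite !mxE eq_w (nth_map i) ?size_enum_ord // nth_ord_enum.
by rewrite (tnth_nth 0).
Qed.

Lemma ext_form_wedge (k : nat) (beta : 'I_k -> {scalar M}) (w : 'I_k -> M) :
  ext_form beta (wedge w) = word_form beta [seq w i | i <- enum 'I_k].
Proof.
rewrite enumT /wedge ext_prod ext_form_pi.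
by rewrite /fsum_form big_seq1 mul1r.
Qed.

End WordForm.

(** * Strictly increasing multiindices and their images *)

Lemma incr_idxP (r k : nat) (J : {ffun 'I_r -> 'I_k}) :
  reflect {homo J : i j / (i < j)%N} (J \in incr_idx r k).
Proof.
rewrite inE; apply: (iffP forallP) => [h i j|h i].
  by move: (h i) => /forallP/(_ j)/implyP.
by apply/forallP => j; apply/implyP; exact: h.
Qed.

Lemma incr_idx_inj (r k : nat) (J : {ffun 'I_r -> 'I_k}) :
  J \in incr_idx r k -> injective J.
Proof.
move=> /incr_idxP hJ i j eq_ij; apply: val_inj.
by case: (ltngtP i j) => // /hJ; rewrite eq_ij ltnn.
Qed.

Lemma incr_idx_codom_sorted (r k : nat) (J : {ffun 'I_r -> 'I_k}) :
  J \in incr_idx r k -> sorted (fun i j : 'I_k => (i < j)%N) (codom J).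
Proof.
move=> /incr_idxP hJ; rewrite /codom /image_mem.
apply: (homo_sorted (f := J) (e := fun i j : 'I_r => (i < j)%N)); first exact: hJ.
by rewrite -(sorted_map (f := val) (e' := ltn)) val_enum_ord iota_ltn_sorted.
Qed.

(** Both images have [r] elements, so the inclusion is an equality, and a finite set has only one
    strictly increasing enumeration. *)
Lemma incr_idx_codom_inj (r k : nat) (J J' : {ffun 'I_r -> 'I_k}) :
  J \in incr_idx r k -> J' \in incr_idx r k ->
  {subset codom J' <= codom J} -> J' = J.
Proof.
move=> hJ hJ' sub.
have eq_mem : codom J' =i codom J.
  apply: (uniq_min_size _ sub _).2; last by rewrite !size_codom.
  by rewrite map_inj_uniq ?enum_uniq //; exact: incr_idx_inj.
have eq_cod : codom J' = codom J.
  apply: (irr_sorted_eq (leT := fun i j : 'I_k => (i < j)%N)).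
  - by move=> a b c; exact: ltn_trans.
  - by move=> a; exact: ltnn.
  - exact: incr_idx_codom_sorted.
  - exact: incr_idx_codom_sorted.
  - exact: eq_mem.
move: eq_cod; rewrite !codomE => /eq_in_map eqJ.
by apply/ffunP => i; apply: eqJ; rewrite mem_enum.
Qed.

(** * The dual basis and the coefficients of an element of the exterior algebra *)

Section DualBasis.
Variables (R : comPzRingType) (M : lmodType R) (m : nat) (e : 'I_m -> M).
Hypothesis he : is_basis e.

Definition basis_coords (v : M) : {ffun 'I_m -> R} := sval (cid (he v)).

Lemma basis_coordsP v : v = \sum_(i < m) basis_coords v i *: e i.
Proof. by have [] := svalP (cid (he v)). Qed.

Lemma basis_coords_uniq v (c : {ffun 'I_m -> R}) :
  v = \sum_(i < m) c i *: e i -> basis_coords v = c.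
Proof. by have [_ h] := svalP (cid (he v)) => /h. Qed.

Definition dual_basis (i : 'I_m) (v : M) : R := basis_coords v i.

Lemma dual_basis_linear i : linear_for *%R (dual_basis i).
Proof.
move=> a u v; rewrite /dual_basis.
rewrite (basis_coords_uniq (c := [ffun j => a * basis_coords u j + basis_coords v j])).
  by rewrite ffunE.
rewrite {1}(basis_coordsP u) {1}(basis_coordsP v) scaler_sumr -big_split /=.
by apply: eq_bigr => j _; rewrite ffunE scalerDl scalerA.
Qed.

HB.instance Definition _ i :=
  GRing.isLinear.Build R M R _ (dual_basis i) (dual_basis_linear i).

Lemma dual_basisE i j : dual_basis i (e j) = (i == j)%:R.
Proof.
rewrite /dual_basis (basis_coords_uniq (c := [ffun l => (l == j)%:R])) ?ffunE //.
rewrite (bigD1 j) //= ffunE eqxx scale1r big1 ?addr0 // => l /negPf ne.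
by rewrite ffunE ne scale0r.
Qed.

Definition dual_idx (k : nat) (L : {ffun 'I_k -> 'I_m}) (j : 'I_k) : {scalar M} :=
  dual_basis (L j).

Lemma dual_idx_wedge (k : nat) (L L' : {ffun 'I_k -> 'I_m}) :
  L \in incr_idx k m -> L' \in incr_idx k m ->
  ext_form (dual_idx L) (wedge_idx e L') = (L == L')%:R.
Proof.
move=> hL hL'; rewrite ext_form_prod; case: eqP => [<-|ne].
  rewrite -[RHS](det1 _ k); congr (\det _); apply/matrixP => i j.
  by rewrite !mxE /= dual_basisE (inj_eq (incr_idx_inj hL)) eq_sym.
have [/subsetP sub|] := boolP (codom L' \subset codom L).
  by case: ne; rewrite (incr_idx_codom_inj hL hL' sub).
(* Some [L' i] lies outside the image of [L], so row [i] of the matrix is zero. *)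
case/subsetPn => _ /codomP [i ->] ni.
rewrite (expand_det_row _ i) big1 // => j _; rewrite !mxE /= dual_basisE.
case: eqP => [eqL|_]; last by rewrite mul0r.
by rewrite -eqL codom_f in ni.
Qed.

(** This turns the generators of [coef_ideal] into values of a form, to which an identity valid for
    all [beta] applies. *)
Lemma ext_form_coords (k : nat) (x : ext M) (c : {ffun 'I_k -> 'I_m} -> R)
    (L : {ffun 'I_k -> 'I_m}) :
  ext_coords e x c -> L \in incr_idx k m -> ext_form (dual_idx L) x = c L.
Proof.
move=> -> hL; rewrite linear_sum (bigD1 L) //= linearZ /= dual_idx_wedge //.
rewrite eqxx mulr1 big1 ?addr0 // => L' /andP [hL' ne].
by rewrite linearZ /= dual_idx_wedge // eq_sym (negPf ne) mulr0.
Qed.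

End DualBasis.

(** * Vanishing on K of the coefficients of a zero sum *)

Section Uniqueness.
Variables (R : comPzRingType) (M : lmodType R) (k r q : nat) (omega : 'I_k -> M).
Variables (gamma : {ffun 'I_r -> 'I_k} -> ext M) (alpha : 'I_q -> {scalar M}).
Hypothesis sum0 : \sum_(J in incr_idx r k) wedge_idx omega J * gamma J = 0.
Hypothesis alphaK : forall j i, in_ker (omega i) (alpha j).

Lemma wedge_form_annihilates (beta : 'I_k -> {scalar M}) (J : {ffun 'I_r -> 'I_k}) :
  J \in incr_idx r k ->
  ext_form beta (wedge omega) * ext_form alpha (gamma J) = 0.
Proof.
(* The complementary indices: multiplying by their wedge isolates the term of [J]. *)
move=> hJ; pose s := enum [predC codom J].
have uJ : uniq (codom J).
  by rewrite map_inj_uniq ?enum_uniq //; exact: incr_idx_inj.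
have permJ : perm_eq (s ++ codom J) (enum 'I_k).
  apply: uniq_perm; rewrite ?enum_uniq //.
    rewrite cat_uniq enum_uniq uJ andbT; apply/hasPn => i iJ.
    by rewrite mem_enum inE /= iJ.
  by move=> i; rewrite mem_cat !mem_enum !inE; case: (i \in codom J).
have szs (J' : {ffun 'I_r -> 'I_k}) : size (s ++ codom J') = k.
  by move/perm_size: permJ; rewrite !size_cat !size_codom size_enum_ord.
have termE (J' : {ffun 'I_r -> 'I_k}) :
    ext_form (forms_cat beta alpha)
      (\prod_(i <- s) ext_in (omega i) * (wedge_idx omega J' * gamma J')) =
    word_form beta [seq omega i | i <- s ++ codom J'] * ext_form alpha (gamma J').
  rewrite mulrA; have -> : wedge_idx omega J' = \prod_(i <- codom J') ext_in (omega i).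
    by rewrite codomE big_map enumT.
  rewrite -big_cat /= -(big_map omega xpredT ext_in) ext_form_catM //.
    by rewrite size_map.
  by move=> _ j /mapP [i _ ->]; exact: alphaK.
have others0 (J' : {ffun 'I_r -> 'I_k}) : (J' \in incr_idx r k) && (J' != J) ->
    ext_form (forms_cat beta alpha)
      (\prod_(i <- s) ext_in (omega i) * (wedge_idx omega J' * gamma J')) = 0.
  case/andP => hJ' ne; rewrite termE word_form_nuniq ?mul0r //.
  (* Without a repeated index, the image of [J'] avoids [s], hence lies in that of [J], which forces
     [J' = J]. *)
  apply: contra ne => /map_uniq; rewrite cat_uniq => /and3P [_ /hasPn disj _].
  apply/eqP; apply: incr_idx_codom_inj => // i /disj.
  by rewrite mem_enum inE /= negbK.
have := congr1 (fun x => ext_form (forms_cat beta alpha)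
  (\prod_(i <- s) ext_in (omega i) * x)) sum0.
rewrite /= mulr0 linear0 big_distrr linear_sum (bigD1 J) //= (big1 _ _ _ others0).
rewrite addr0 termE ext_form_wedge.
(* Sorting [s ++ codom J] into the order of [wedge omega] costs a sign, which is its own inverse. *)
have [b ->] := word_form_perm beta (perm_map omega permJ).
by rewrite -mulrA => /(congr1 ( *%R ((-1) ^+ b))); rewrite mulr0 signrMK.
Qed.

(** Each coefficient of [wedge omega] is its value on a family [dual_idx e L], hence annihilates the
    value of [gamma J]; so does their combination [a], which is cancellable. *)
Lemma ext_form_eq0 (m : nat) (e : 'I_m -> M) (a : R) (J : {ffun 'I_r -> 'I_k}) :
  is_basis e -> coef_ideal e k (wedge omega) a -> GRing.lreg a ->
  J \in incr_idx r k -> ext_form alpha (gamma J) = 0.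
Proof.
move=> he [c hc [d aE]] rega hJ; apply: rega; rewrite mulr0 aE big_distrl /=.
apply: big1 => L hL; rewrite -(ext_form_coords he hc hL) -mulrA.
by rewrite wedge_form_annihilates // mulr0.
Qed.

End Uniqueness.

Theorem theorem2p8 (R : comPzRingType) (m : nat) (M : lmodType R)
    (e : 'I_m -> M) (he : is_basis e)
    (k : nat) (hk : (1 <= k <= m)%N) (omega : 'I_k -> M)
    (p r : nat) (hpm : (p <= m)%N) (hrp : (r <= p)%N) (hr : (1 <= r)%N)
    (hI : exists2 a : R, coef_ideal e k (wedge omega) a & GRing.lreg a)
    (eta : ext M) (heta : ext_deg p eta) :
  (forall gamma gamma' : {ffun 'I_r -> 'I_k} -> ext M,
     (forall J, J \in incr_idx r k -> ext_deg (p - r) (gamma J)) ->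
     (forall J, J \in incr_idx r k -> ext_deg (p - r) (gamma' J)) ->
     eta = \sum_(J in incr_idx r k) wedge_idx omega J * gamma J ->
     eta = \sum_(J in incr_idx r k) wedge_idx omega J * gamma' J ->
     forall alpha : 'I_(p - r) -> {scalar M},
       (forall j i, in_ker (omega i) (alpha j)) ->
       forall J, J \in incr_idx r k ->
         ext_form alpha (gamma J) = ext_form alpha (gamma' J))
  /\
  (forall (b b' : R) (hb : GRing.lreg b) (hb' : GRing.lreg b')
      (gamma gamma' : {ffun 'I_r -> 'I_k} -> ext M),
     (forall J, J \in incr_idx r k -> ext_deg (p - r) (gamma J)) ->
     (forall J, J \in incr_idx r k -> ext_deg (p - r) (gamma' J)) ->
     b *: eta = \sum_(J in incr_idx r k) wedge_idx omega J * gamma J ->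
     b' *: eta = \sum_(J in incr_idx r k) wedge_idx omega J * gamma' J ->
     forall alpha : 'I_(p - r) -> {scalar M},
       (forall j i, in_ker (omega i) (alpha j)) ->
       forall J, J \in incr_idx r k ->
         tfrac (ext_form alpha (gamma J)) hb =
         tfrac (ext_form alpha (gamma' J)) hb').
Proof.
have [a aI rega] := hI.
(* The cross-multiplied identity serves both claims: it is the equality of fractions in (ii), and
   taking [b = b' = 1] gives (i). *)
have crossE b b' gamma gamma' :
    b *: eta = \sum_(J in incr_idx r k) wedge_idx omega J * gamma J ->
    b' *: eta = \sum_(J in incr_idx r k) wedge_idx omega J * gamma' J ->
    forall alpha : 'I_(p - r) -> {scalar M},
      (forall j i, in_ker (omega i) (alpha j)) ->
      forall J, J \in incr_idx r k ->
        ext_form alpha (gamma J) * b' = b * ext_form alpha (gamma' J).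
  move=> E E' alpha alphaK J hJ; apply/eqP; rewrite -subr_eq0 mulrC; apply/eqP.
  (* The family [b' *: gamma J - b *: gamma' J] has sum
     [b' *: (b *: eta) - b *: (b' *: eta) = 0]. *)
  have := @ext_form_eq0 R M k r _ omega
    (fun J => b' *: gamma J - b *: gamma' J) alpha _ alphaK m e a J he aI rega hJ.
  rewrite linearB !linearZ; apply.
  under eq_bigr do rewrite mulrBr -!ext_scalerAr.
  by rewrite sumrB -!scaler_sumr -E -E' !scalerA mulrC subrr.
split=> [gamma gamma' _ _ E E' alpha alphaK J hJ|
         b b' hb hb' gamma gamma' _ _ E E' alpha alphaK J hJ].
  rewrite -[LHS]mulr1 -[RHS]mul1r.
  by apply: crossE alphaK J hJ; rewrite scale1r.
by apply/tfracP; exact: crossE E E' alpha alphaK J hJ.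
Qed.
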